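(* Let $\mathcal T$ be a spherically homogeneous rooted tree and let $G$ be a group of automorphisms of $\mathcal T$. If, for each vertex $u$ of $\mathcal T$, the rigid vertex stabilizer $L_u=\mathrm{Rst}_G(u)$ contains a non-trivial element of finite order, then $G$ has elements of unbounded finite order (for every $N$ there is an element of $G$ whose order is finite and larger than $N$). Further: (1) Every weakly branch torsion group has infinite exponent. (2) For every prime $p$, every weakly branch $p$-group contains an isomorphic copy of every finite $p$-group. (3) Every weakly regular branch group either is weakly regular branch over a torsion-free subgroup, or, for some prime $p$, contains an isomorphic copy of every finite $p$-group. (4) Every regular branch group either is virtually torsion-free or, for some prime $p$, contains an isomorphic copy of every finite $p$-group.
   Context: Let $m_1,m_2,\dots$ be integers $\ge 2$ and let $Y_i$ be a set with $m_i$ elements. The spherically homogeneous rooted tree $\mathcal T$ is the set of all finite words $y_1\cdots y_n$ with $y_i\in Y_i$, ordered by the prefix relation; the level $\mathcal L_n$ is the set of words of length $n$. An automorphism is a permutation of the words preserving the prefix relation. Groups act on the right. If all $Y_i$ equal $Y=\{1,\dots,m\}$ the tree is regular and denoted $\mathcal T^{(m)}$. For an automorphism $f$ and a word $u$ of length $n$, the section $f_u$ is the automorphism of the tree over $Y_{n+1},Y_{n+2},\dots$ determined by $(uv)^f=u^f v^{f_u}$. For a group $G$ of automorphisms: $\mathrm{St}_G(\mathcal L_n)$ is the subgroup fixing every vertex of level $n$; $\mathrm{Rst}_G(u)$ is the subgroup of those elements fixing every vertex that does not have $u$ as a prefix; $\mathrm{Rst}_G(\mathcal L_n)=\prod_{u\in\mathcal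 L_n}\mathrm{Rst}_G(u)$. The map $\psi:\mathrm{St}_G(\mathcal L_1)\to\prod_{y\in Y_1}\mathrm{Aut}(\mathcal T_1)$, $g\mapsto (g_y)_{y\in Y_1}$ (with $\mathcal T_1$ the tree over $Y_2,Y_3,\dots$) is an embedding. $G$ acts spherically transitively if it is transitive on each level. A spherically transitive $G$ is a branch group acting on $\mathcal T$ if all $\mathrm{Rst}_G(\mathcal L_n)$ have finite index in $G$, and a weakly branch group if all rigid vertex stabilizers are non-trivial. On a regular tree, $G$ is fractal if for every vertex $u$ the group $\{g_u : g\in G,\ u^g=u\}$ equals $G$. A fractal branch group $G$ acting on $\mathcal T^{(m)}$ is regular branch if there is a finite-index subgroup $K$ of $G$ such that $K^m=K\times\dots\times K$ is contained in $\psi(K\cap \mathrm{St}_G(\mathcal L_1))$ as a subgroup of finite index. A fractal group acting spherically transitively on $\mathcal T^{(m)}$ is weakly regular branch over a non-trivial subgroup $K$ if $K^m\le\psi(K\cap \mathrm{St}_G(\mathcal L_1))$ (the index being allowed to be infinite), and it is weakly regular branch if it is so over some non-trivial $K$. A $p$-group is a group all of whose elements have order a power of $p$. *)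

(* Defs.v *)
From HB Require Import structures.
From mathcomp Require Import all_boot all_fingroup all_solvable.
From mathcomp Require Import boolp classical_sets cardinality.

Set Implicit Arguments.
Unset Strict Implicit.
Unset Printing Implicit Defensive.

Local Open Scope classical_set_scope.
Local Open Scope group_scope.

(* The alphabet of the i-th letter is [Y i], starting at i = 0 (the usual      *)
(* indexing Y_1, Y_2, ... is shifted by one).  The alphabet sequence is a      *)
(* non-uniform parameter, so that the words over Y_{n+1}, Y_{n+2}, ... have    *)
(* the type [word (shift n Y)].                                                *)
Inductive word (Y : nat -> finType) : Type :=
| wnil
| wcons (y : Y 0) (w : word (fun i => Y i.+1)).

Arguments wnil {Y}.
Arguments wcons {Y} y w.

(* On a constant sequence, [shift n (fun=> T)] is convertible to [fun=> T]. *)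
Definition shift (n : nat) (Y : nat -> finType) : nat -> finType :=
  fun i => Y (n + i)%N.

Fixpoint wlen Y (u : word Y) : nat :=
  if u is wcons _ u' then (wlen u').+1 else 0.

Fixpoint wprefix Y (u : word Y) : word Y -> bool :=
  match u with
  | wnil => fun=> true
  | wcons y u' => fun v =>
      if v is wcons z v' then (y == z) && wprefix u' v' else false
  end.

Fixpoint wcat Y (u : word Y) : word (shift (wlen u) Y) -> word Y :=
  match u return word (shift (wlen u) Y) -> word Y with
  | wnil => fun v => v
  | wcons y u' => fun v => wcons y (@wcat _ u' v)
  end.

Fixpoint wdrop (n : nat) Y (w : word Y) : word (shift n Y) :=
  match n return word (shift n Y) with
  | 0 => w
  | n'.+1 => if w is wcons _ w' then wdrop n' w' else wnil
  end.

Fixpoint tree_level (n : nat) (Y : nat -> finType) : seq (word Y) :=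
  if n is n'.+1 then
    [seq wcons y w | y <- enum (Y 0), w <- tree_level n' (fun i => Y i.+1)]
  else [:: wnil].

HB.instance Definition _ Y := gen_eqMixin (word Y).

Lemma mem_level n Y (u : word Y) : (u \in tree_level n Y) = (wlen u == n).
Proof.
elim: n Y u => [|n IH] Y [|y u] /=; rewrite ?inE ?eqxx //.
- by apply/eqP.
- by apply/negP => /allpairsPdep[z [w [_ _]]].
rewrite eqSS -IH; apply/allpairsPdep/idP => [[z [w [_ wl [_ E]]]]|ul].
  by rewrite E.
by exists y, u; rewrite mem_enum.
Qed.

Lemma level_uniq n Y : uniq (tree_level n Y).
Proof.
elim: n Y => [|n IH] Y //=; apply: allpairs_uniq; rewrite ?enum_uniq ?IH //.
by move=> [y v] [z w] _ _ /= [-> ->].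
Qed.

Record tree_aut (Y : nat -> finType) : Type := TreeAut {
  aut_fun :> word Y -> word Y;
  aut_bij : bijective aut_fun;
  aut_prefix : forall u v, wprefix (aut_fun u) (aut_fun v) = wprefix u v }.

Lemma aut_ext Y (f g : tree_aut Y) : f =1 g -> f = g.
Proof.
case: f g => [f fb fp] [g gb gp] /= /funext fg; subst g.
by congr TreeAut; apply: Prop_irrelevance.
Qed.

HB.instance Definition _ Y := gen_eqMixin (tree_aut Y).
HB.instance Definition _ Y := gen_choiceMixin (tree_aut Y).

Lemma aut_inv_ex Y (f : tree_aut Y) :
  exists g : tree_aut Y, cancel f g /\ cancel g f.
Proof.
case: f => f [g fK gK] fp; have gp u v : wprefix (g u) (g v) = wprefix u v.
  by rewrite -fp !gK.
by exists (TreeAut (Bijective gK fK) gp).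
Qed.

Definition aut_inv Y (f : tree_aut Y) : tree_aut Y :=
  sval (cid (aut_inv_ex f)).

Lemma aut_invK Y (f : tree_aut Y) : cancel (aut_inv f) f.
Proof. by rewrite /aut_inv; case: cid => g []. Qed.

Lemma autK Y (f : tree_aut Y) : cancel f (aut_inv f).
Proof. by rewrite /aut_inv; case: cid => g []. Qed.

Definition aut_one Y : tree_aut Y :=
  @TreeAut Y id (Bijective (fun=> erefl) (fun=> erefl)) (fun _ _ => erefl).

Lemma aut_mul_prefix Y (f g : tree_aut Y) u v :
  wprefix ((g \o f) u) ((g \o f) v) = wprefix u v.
Proof. by rewrite /= !aut_prefix. Qed.

(* Groups act on the right: the image of u under f * g is (u^f)^g. *)
Definition aut_mul Y (f g : tree_aut Y) : tree_aut Y :=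
  @TreeAut Y (g \o f) (bij_comp (aut_bij g) (aut_bij f)) (aut_mul_prefix f g).

Lemma aut_mulA Y : associative (@aut_mul Y).
Proof. by move=> f g h; apply: aut_ext. Qed.
Lemma aut_mul1 Y : left_id (aut_one Y) (@aut_mul Y).
Proof. by move=> f; apply: aut_ext. Qed.
Lemma aut_mulr1 Y : right_id (aut_one Y) (@aut_mul Y).
Proof. by move=> f; apply: aut_ext. Qed.
Lemma aut_mulV Y : left_inverse (aut_one Y) (@aut_inv Y) (@aut_mul Y).
Proof. by move=> f; apply: aut_ext => u /=; rewrite aut_invK. Qed.
Lemma aut_mulrV Y : right_inverse (aut_one Y) (@aut_inv Y) (@aut_mul Y).
Proof. by move=> f; apply: aut_ext => u /=; rewrite autK. Qed.

HB.instance Definition _ Y := isGroup.Build (tree_aut Y)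
  (@aut_mulA Y) (@aut_mul1 Y) (@aut_mulr1 Y) (@aut_mulV Y) (@aut_mulrV Y).

Lemma wprefix_refl Y (u : word Y) : wprefix u u.
Proof. by elim: u => //= Z y u ->; rewrite eqxx. Qed.

Lemma wprefix_len Y (u v : word Y) : wprefix u v -> wlen u <= wlen v.
Proof.
by elim: u v => //= Z y u IH [|z v] //= /andP[_ /IH].
Qed.

Lemma wprefix_eq Y (u v : word Y) :
  wprefix u v -> wlen u = wlen v -> u = v.
Proof.
elim: u v => [Z|Z y u IH] [|z v] //= /andP[/eqP <-] /IH uv [] /uv -> //.
Qed.

Lemma wprefix_parent Y (u : word Y) n : wlen u = n.+1 ->
  exists2 v, wprefix v u & wlen v = n.
Proof.
elim: u n => //= Z y u IH [|n] [] un; first by exists wnil.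
have [v vu vn] := IH _ un.
by exists (wcons y v) => /=; rewrite ?eqxx ?vn.
Qed.

Lemma aut_len_le Y (f : tree_aut Y) u : wlen u <= wlen (f u).
Proof.
have [n] : exists n, wlen u = n by exists (wlen u).
elim: n u => [|n IH] u un; first by rewrite un.
have [v vu vn] := wprefix_parent un.
have fvu : wprefix (f v) (f u) by rewrite aut_prefix.
rewrite un -vn; apply: leq_ltn_trans (IH v vn) _.
rewrite ltn_neqAle wprefix_len // andbT; apply/eqP => /(wprefix_eq fvu).
by move/(bij_inj (aut_bij f)) => vE; move: un; rewrite -vE vn => /n_Sn.
Qed.

Lemma aut_len Y (f : tree_aut Y) u : wlen (f u) = wlen u.
Proof.
apply/eqP; rewrite eqn_leq aut_len_le andbT.
by rewrite -{2}(autK f u) aut_len_le.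
Qed.

Lemma wprefix_cat Y (u : word Y) v : wprefix u (wcat (u := u) v).
Proof. by elim: u v => //= Z y u IH v; rewrite eqxx IH. Qed.

Lemma wprefix_cat2 Y (u : word Y) v w :
  wprefix (wcat (u := u) v) (wcat (u := u) w) = wprefix v w.
Proof. by elim: u v w => //= Z y u IH v w; rewrite eqxx IH. Qed.

Lemma wcatK Y (u : word Y) v : wdrop (wlen u) (wcat (u := u) v) = v.
Proof. by elim: u v => //= Z y u IH v. Qed.

Lemma wdropK Y (u w : word Y) :
  wprefix u w -> wcat (u := u) (wdrop (wlen u) w) = w.
Proof.
by elim: u w => [//|Z y u IH] [|z w] //= /andP[/eqP <- uw]; rewrite IH.
Qed.

Lemma wprefix_drop Y n (u v w : word Y) : wlen u = n ->
  wprefix u v -> wprefix u w ->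
  wprefix (wdrop n v) (wdrop n w) = wprefix v w.
Proof. by move=> <- uv uw; rewrite -wprefix_cat2 !wdropK. Qed.

Lemma wdrop_surj Y n (u : word Y) (v : word (shift n Y)) : wlen u = n ->
  exists2 w, wprefix u w & wdrop n w = v.
Proof.
by move=> un; subst n; exists (wcat v); rewrite ?wprefix_cat ?wcatK.
Qed.

Lemma wprefix_anti Y (u v : word Y) : wprefix u v -> wprefix v u -> u = v.
Proof.
move=> uv vu; apply: wprefix_eq => //.
by apply/eqP; rewrite eqn_leq !wprefix_len.
Qed.

(* Since (uv)^f has u^f as a prefix and |u^f| = |u|, the defining equation      *)
(* (uv)^f = u^f v^(f_u) says that v^(f_u) is (uv)^f without its first |u|      *)
(* letters; [sectionP] states it with the cast along |u^f| = |u|.              *)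
Definition section_fun Y (f : tree_aut Y) (u : word Y)
    (v : word (shift (wlen u) Y)) : word (shift (wlen u) Y) :=
  wdrop (wlen u) (f (wcat v)).

Lemma section_prefix Y (f : tree_aut Y) (u : word Y) v w :
  wprefix (section_fun f (u := u) v) (section_fun f w) = wprefix v w.
Proof.
rewrite (@wprefix_drop _ _ (f u)) ?aut_len ?aut_prefix ?wprefix_cat2 //;
  exact: wprefix_cat.
Qed.

Lemma section_bij Y (f : tree_aut Y) (u : word Y) :
  bijective (section_fun f (u := u)).
Proof.
have sur v : exists w, section_fun f (u := u) w = v.
  have [x px <-] := wdrop_surj v (aut_len f u).
  exists (wdrop (wlen u) (aut_inv f x)).
  by rewrite /section_fun wdropK ?aut_invK // -(aut_prefix f) aut_invK.
have K v : section_fun f (sval (cid (sur v))) = v by case: cid.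
exists (fun v => sval (cid (sur v))) => // v.
by apply: wprefix_anti; rewrite -(section_prefix f) K wprefix_refl.
Qed.

Definition aut_section Y (f : tree_aut Y) (u : word Y) :
    tree_aut (shift (wlen u) Y) :=
  TreeAut (section_bij f u) (section_prefix f (u := u)).

Lemma sectionP Y (f : tree_aut Y) (u : word Y) (v : word (shift (wlen u) Y)) :
  wprefix (f u) (f (wcat v)) /\ wdrop (wlen (f u)) (f (wcat v)) =
    ecast n (word (shift n Y)) (esym (aut_len f u)) (aut_section f u v).
Proof.
split; first by rewrite aut_prefix wprefix_cat.
rewrite [aut_section f u v]/=/section_fun.
by move: (esym _); move: (wlen (f u)) => n e; subst n.
Qed.

Definition finite_index (gT : groupType) (H G : set gT) : Prop :=
  finite_set [set [set h * g | h in H] | g in G].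

Definition is_subgroup (gT : groupType) (H G : set gT) : Prop :=
  H `<=` G /\ group_closed [in H].

Definition finite_order (gT : groupType) (g : gT) : Prop :=
  exists2 n, (0 < n)%N & g ^+ n = 1.

Definition has_order (gT : groupType) (g : gT) (n : nat) : Prop :=
  [/\ (0 < n)%N, g ^+ n = 1 & forall k, (0 < k < n)%N -> g ^+ k <> 1].

Definition nontrivial (gT : groupType) (G : set gT) : Prop :=
  exists2 g, G g & g <> 1.

Definition torsion (gT : groupType) (G : set gT) : Prop :=
  forall g, G g -> finite_order g.

Definition torsion_free (gT : groupType) (G : set gT) : Prop :=
  forall g, G g -> finite_order g -> g = 1.

Definition finite_exponent (gT : groupType) (G : set gT) : Prop :=
  exists2 n, (0 < n)%N & forall g, G g -> g ^+ n = 1.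

Definition is_pgroup (p : nat) (gT : groupType) (G : set gT) : Prop :=
  forall g, G g -> exists k, has_order g (p ^ k)%N.

Definition virtually_torsion_free (gT : groupType) (G : set gT) : Prop :=
  exists H : set gT, [/\ is_subgroup H G, finite_index H G & torsion_free H].

Definition contains_copy (gT : groupType) (G : set gT)
    (hT : finGroupType) (P : {group hT}) : Prop :=
  exists f : hT -> gT,
    [/\ {in P &, injective f}, {in P &, {morph f : x y / x * y}}
      & forall x, x \in P -> G (f x)].

Definition contains_all_finite_pgroups (p : nat) (gT : groupType)
    (G : set gT) : Prop :=
  forall (hT : finGroupType) (P : {group hT}),
    p.-group P -> contains_copy G P.

Section Tree.
Variable Y : nat -> finType.
Implicit Types G : set (tree_aut Y).

Definition level_stab G (n : nat) : set (tree_aut Y) :=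
  [set g | G g /\ forall v : word Y, wlen v = n -> g v = v].

Definition rigid_stab G (u : word Y) : set (tree_aut Y) :=
  [set g | G g /\ forall v : word Y, ~~ wprefix u v -> g v = v].

(* The factors commute, so the order of the vertices is immaterial. *)
Definition rigid_level_stab G (n : nat) : set (tree_aut Y) :=
  [set g | exists2 r : word Y -> tree_aut Y,
     forall u, wlen u = n -> rigid_stab G u (r u) &
     g = \prod_(u <- tree_level n Y) r u].

Definition spherically_transitive G : Prop :=
  forall u v : word Y, wlen u = wlen v -> exists2 g, G g & g u = v.

Definition branch G : Prop :=
  spherically_transitive G /\
  forall n, finite_index (rigid_level_stab G n) G.

Definition weakly_branch G : Prop :=
  spherically_transitive G /\ forall u, nontrivial (rigid_stab G u).

(* Only meant for elements fixing every word of length 1. *)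
Definition psi (g : tree_aut Y) : {ffun Y 0 -> tree_aut (fun i => Y i.+1)} :=
  [ffun y => aut_section g (wcons y wnil)].

End Tree.

Definition regular_tree (m : nat) : nat -> finType := fun=> 'I_m.

Section RegularTree.
Variable m : nat.
Implicit Types G K : set (tree_aut (regular_tree m)).

Definition fractal G : Prop :=
  forall u : word (regular_tree m),
    [set (aut_section g u : tree_aut (regular_tree m)) |
      g in [set g | G g /\ g u = u]] = G.

Definition direct_power K : set {ffun 'I_m -> tree_aut (regular_tree m)} :=
  [set k | forall y, K (k y)].

Definition psi_image K : set {ffun 'I_m -> tree_aut (regular_tree m)} :=
  [set psi g | g in level_stab K 1%N].

Definition regular_branch G : Prop :=
  [/\ fractal G, branch G & exists K,
    [/\ is_subgroup K G, finite_index K G,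
        direct_power K `<=` psi_image K &
        finite_index (direct_power K) (psi_image K)]].

Definition weakly_regular_branch_over G K : Prop :=
  [/\ fractal G, spherically_transitive G, is_subgroup K G, nontrivial K
    & direct_power K `<=` psi_image K].

Definition weakly_regular_branch G : Prop :=
  exists K, weakly_regular_branch_over G K.

End RegularTree.

(* Main.v *)
(* If g in Rst(u) has prime order p and moves v, then the vertices v^(g^i),
   i < p, are distinct and below u, so g together with any subgroup H of Rst(v)
   generates H wr C_p inside Rst(u). By the Kaloujnine-Krasner embedding, a
   finite group with a normal subgroup N of index p then embeds into Rst(u) as
   soon as N embeds into Rst(v). Climbing the tree, one gets cyclic groups of
   unbounded order from C_n < C_(np), and every finite p-group when p can be
   kept constant. In the (weakly) regular branch case, a torsion element of the
   branching subgroup K is copied below every vertex. *)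

Require Import Defs.
From HB Require Import structures.
From mathcomp Require Import all_boot all_fingroup all_solvable.
From mathcomp Require Import zmodp.
From mathcomp Require Import boolp classical_sets cardinality.

Local Open Scope classical_set_scope.
Local Open Scope group_scope.

Set Implicit Arguments.
Unset Strict Implicit.
Unset Printing Implicit Defensive.

(** * Subgroups as sets, elements of prime order, copies of finite groups *)

Lemma set_group1 (gT : groupType) (G : set gT) : group_closed [in G] -> G 1.
Proof. by case; rewrite inE. Qed.

Lemma set_groupM (gT : groupType) (G : set gT) g h :
  group_closed [in G] -> G g -> G h -> G (g * h).
Proof.
move=> /group_closedM GM Gg Gh.
by have := GM g h; rewrite !inE; apply.
Qed.

Lemma set_groupV (gT : groupType) (G : set gT) g :
  group_closed [in G] -> G g -> G g^-1.
Proof.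
by move=> /group_closedV GV Gg; have := GV g; rewrite !inE; apply.
Qed.

Lemma set_groupX (gT : groupType) (G : set gT) g n :
  group_closed [in G] -> G g -> G (g ^+ n).
Proof.
move=> GG Gg; elim: n => [|n IH]; first by rewrite expg0; apply: set_group1.
by rewrite expgS; apply: set_groupM.
Qed.

(** Strong induction on [n], which need not be the exact order: for the least prime divisor q of
    [n], either [g] to the power n/q is the required element, or n/q replaces [n]. Keeping [p] a
    divisor of [n] pins it down when [n] is a prime power. *)
Lemma finite_order_prime_power (gT : groupType) (g : gT) n :
  (0 < n)%N -> g ^+ n = 1 -> g <> 1 ->
  exists p k, [/\ prime p, (p %| n)%N, g ^+ k <> 1 & (g ^+ k) ^+ p = 1].
Proof.
have [m] := ubnP n; elim: m n => // m IH n ltnm n_gt0 gn1 g1.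
have n_gt1 : (1 < n)%N.
  by case: n gn1 n_gt0 {ltnm} => [|[|n]] //; rewrite expg1.
have pr := pdiv_prime n_gt1; have dv := pdiv_dvd n.
have [gk1|gk1] := pselect (g ^+ (n %/ pdiv n) = 1); last first.
  by exists (pdiv n), (n %/ pdiv n); split; rewrite // -expgM divnK.
have q_lt : (n %/ pdiv n < n)%N by rewrite ltn_Pdiv // prime_gt1.
have q_gt0 : (0 < n %/ pdiv n)%N by rewrite divn_gt0 ?prime_gt0 // dvdn_leq.
have [p [k [pp pd gk gkp]]] :=
  IH _ (leq_trans q_lt (ltnSE ltnm)) q_gt0 gk1 g1.
by exists p, k; split=> //; apply: dvdn_trans pd (dvdn_div dv).
Qed.

Lemma contains_copy_sub (gT : groupType) (G H : set gT) (hT : finGroupType)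
    (P : {group hT}) : G `<=` H -> contains_copy G P -> contains_copy H P.
Proof. by move=> GH [f [fi fM fG]]; exists f; split=> // x /fG /GH. Qed.

Lemma contains_copy_trivial (gT : groupType) (G : set gT) (hT : finGroupType)
    (P : {group hT}) : group_closed [in G] -> P :=: 1 -> contains_copy G P.
Proof.
move=> GG P1; exists (fun=> 1); rewrite P1; split.
- by move=> x y /set1P -> /set1P ->.
- by move=> x y _ _; rewrite mulg1.
- by move=> x _; apply: set_group1.
Qed.

Lemma contains_cyclic_order (gT : groupType) (G : set gT)
    (hT : finGroupType) (x : hT) :
  contains_copy G <[x]> -> exists2 g, G g & has_order g #[x].
Proof.
case=> f [fi fM fG]; exists (f x); first exact/fG/cycle_id.
have f1 : f 1 = 1 by apply: (mulgI (f 1)); rewrite -fM ?mulg1 ?group1.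
have fX k : f x ^+ k = f (x ^+ k).
  by elim: k => [|k IH]; rewrite ?expg0 ?f1 // !expgS IH fM
    ?cycle_id ?mem_cycle.
split; first exact: order_gt0.
  by rewrite fX expg_order.
move=> k /andP[k0 kx]; rewrite fX -f1 => /fi.
rewrite mem_cycle group1 => /(_ isT isT)/eqP.
by rewrite -order_dvdn gtnNdvd.
Qed.

(** * Rigid vertex stabilizers *)

Section RigidStabilizers.
Variable Y : nat -> finType.
Implicit Types (G : set (tree_aut Y)) (g h : tree_aut Y) (u v w : word Y).

Lemma wprefix_trans u v w : wprefix u v -> wprefix v w -> wprefix u w.
Proof.
elim: u v w => // Z y u IH [|z v] //= [|t w] //= /andP[/eqP -> uv] /andP[-> vw].
exact: IH vw.
Qed.

Lemma wprefix_level u v w :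
  wlen u = wlen v -> wprefix u w -> wprefix v w -> u = v.
Proof.
elim: u v w => [Z|Z y u IH] [|z v] //= [|t w] //= [uv].
by move=> /andP[/eqP -> uw] /andP[/eqP -> vw]; rewrite (IH v w).
Qed.

Lemma aut_inj g : injective g.
Proof. exact/bij_inj/aut_bij. Qed.

Lemma autX g n w : (g ^+ n) w = iter n g w.
Proof. by elim: n w => [|n IH] w; rewrite ?expg0 // expgSr /= IH. Qed.

Lemma autXD g m n w : (g ^+ (m + n)) w = (g ^+ n) ((g ^+ m) w).
Proof. by rewrite expgD. Qed.

Lemma aut_conj g h w : (h ^ g) (g w) = g (h w).
Proof. by rewrite conjgE /= autK. Qed.

Lemma rigid_stab_sub G H u : G `<=` H -> rigid_stab G u `<=` rigid_stab H u.
Proof. by move=> GH g [/GH Hg gu]. Qed.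

Lemma rigid_stab_group G u :
  group_closed [in G] -> group_closed [in rigid_stab G u].
Proof.
move=> GG; split; first by rewrite inE; split; first exact: set_group1.
move=> g h; rewrite !inE => -[Gg gu] [Gh hu]; split.
  by apply: set_groupM => //; apply: set_groupV.
by move=> w uw /=; rewrite gu //; apply: (@aut_inj h); rewrite aut_invK hu.
Qed.

(** It suffices that [g] fixes [u]. Otherwise [g u], having the length of [u], is not below [u], so
    [g] fixes [g u], and injectivity gives [g u = u]. *)
Lemma rigid_stab_wprefix G u g w :
  rigid_stab G u g -> wprefix u (g w) = wprefix u w.
Proof.
case=> _ gu; suff {1}<- : g u = u by rewrite aut_prefix.
have [/wprefix_eq <-|/gu] := boolP (wprefix u (g u)); rewrite ?aut_len //.
exact: aut_inj.
Qed.

Lemma rigid_stab_conj G v g h : group_closed [in G] ->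
  G g -> rigid_stab G v h -> rigid_stab G (g v) (h ^ g).
Proof.
move=> GG Gg [Gh hv]; split.
  by rewrite conjgE; do !apply: set_groupM => //; apply: set_groupV.
move=> w; rewrite -[w](aut_invK g) aut_prefix aut_conj => vw.
by rewrite hv.
Qed.

(** The witness is the product of the [r i]. Each factor preserves the subtree below its own [v i]
    and is trivial on the other ones, which are disjoint from it, so the factors do not
    interfere. *)
Lemma rigid_stab_glue G p (v : nat -> word Y) (r : nat -> tree_aut Y) :
  group_closed [in G] ->
  (forall i j w, (i < p)%N -> (j < p)%N ->
     wprefix (v i) w -> wprefix (v j) w -> i = j) ->
  (forall i, (i < p)%N -> rigid_stab G (v i) (r i)) ->
  exists b, [/\ G b,
    forall i w, (i < p)%N -> wprefix (v i) w -> b w = r i w &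
    forall w, (forall i, (i < p)%N -> ~~ wprefix (v i) w) -> b w = w].
Proof.
move=> GG; elim: p => [|p IH] dv rv.
  by exists 1; split=> //; apply: set_group1.
have [i j w ip jp|i ip|b [Gb bv bnv]] := IH; first by apply: dv; apply: ltnW.
  exact/rv/ltnW.
have [Grp rpf] := rv p (ltnSn p).
exists (b * r p); split; first exact: set_groupM.
  move=> i w; rewrite ltnS leq_eqVlt => /predU1P[->|ip] vw /=.
    rewrite bnv // => j jp; apply/negP => /(dv j p w (ltnW jp) (ltnSn p)).
    by move=> /(_ vw) jE; rewrite jE ltnn in jp.
  rewrite (bv i) //; apply: rpf; apply/negP.
  have vr : wprefix (v i) (r i w).
    by rewrite (rigid_stab_wprefix _ (rv i (ltnW ip))).
  by move=> /(dv i p _ (ltnW ip) (ltnSn p) vr) iE; rewrite iE ltnn in ip.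
move=> w nw /=; rewrite bnv ?rpf ?nw // => i ip.
by rewrite nw // ltnW.
Qed.

End RigidStabilizers.

(** * Wreath products with a cyclic group of prime order *)

Section Wreath.
Variables (Y : nat -> finType) (G : set (tree_aut Y)) (u v : word Y).
Variables (g : tree_aut Y) (p : nat).
Hypotheses (GG : group_closed [in G]) (pr_p : prime p).
Hypotheses (gu : rigid_stab G u g) (gp : g ^+ p = 1) (gv : g v <> v).

Lemma autX_modp n : g ^+ (n %% p) = g ^+ n.
Proof. by rewrite {2}(divn_eq n p) expgD mulnC expgM gp expg1n mul1g. Qed.

(** If [p] did not divide [n], Bezout would give a multiple of [n] congruent to 1 modulo [p], so [g]
    itself would fix [v]. *)
Lemma autX_fix n : (g ^+ n) v = v -> (p %| n)%N.
Proof.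
move=> gn; apply: contra_notT gv => pn.
have n0 : (0 < n)%N by case: n pn {gn} => //; rewrite dvdn0.
have [a _ /dvdnP[b E]] := Bezoutl p n0.
have cop : gcdn n p = 1%N.
  by apply/eqP; rewrite -/(coprime n p) coprime_sym prime_coprime.
have fixb : (g ^+ (b * n)) v = v.
  by elim: b {E} => [|b IH]; rewrite ?mul0n ?expg0 // mulSn autXD gn.
have := fixb; rewrite -E cop autXD expg1 mulnC expgM gp expg1n //.
Qed.

(** A vertex not below [u] is fixed by [g]. As [g] commutes with its powers, [g] fixing [(g ^+ n) v]
    would force [g v = v]. *)
Lemma autX_below n : wprefix u ((g ^+ n) v).
Proof.
case: gu => _ gfix; apply: contra_notT gv => /gfix E.
by apply: (@aut_inj Y (g ^+ n)); rewrite -[LHS]/((g * g ^+ n) v) -expgS expgSr.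
Qed.

(** Two orbit vertices have the same length, so a common extension makes them equal; then
    [g ^+ (j - i)] fixes [v], and [p] divides [j - i], which is less than [p]. *)
Lemma autX_disjoint i j w : (i < p)%N -> (j < p)%N ->
  wprefix ((g ^+ i) v) w -> wprefix ((g ^+ j) v) w -> i = j.
Proof.
wlog ij : i j / (i <= j)%N => [H|] ip jp iw jw.
  by have [/H|/ltnW/H E] := leqP i j; [|apply/esym]; auto.
have /esym E : (g ^+ i) v = (g ^+ j) v.
  by apply: wprefix_level iw jw; rewrite !aut_len.
move: E; rewrite -{1}(subnK ij) autXD => /aut_inj/autX_fix.
move=> pj; apply/eqP; rewrite eqn_leq ij -subn_eq0 /=.
case: (posnP (j - i)) pj => // /dvdn_leq H /H.
by rewrite leqNgt (leq_ltn_trans (leq_subr _ _) jp).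
Qed.

Definition on_orbit w := exists2 i, (i < p)%N & wprefix ((g ^+ i) v) w.

(** The inverse of [g ^+ n] is written as [g ^+ (n * p.-1)], to stay within natural exponents. *)
Lemma on_orbitX n w : on_orbit ((g ^+ n) w) -> on_orbit w.
Proof.
case=> i ip iw; exists ((i + n * p.-1) %% p); first
  by rewrite ltn_mod prime_gt0.
rewrite autX_modp autXD.
have -> : w = (g ^+ (n * p.-1)) ((g ^+ n) w); last by rewrite aut_prefix.
by rewrite -autXD -mulnS prednK ?prime_gt0 // mulnC expgM gp expg1n.
Qed.

Variables (hT : finGroupType) (P N : {group hT}).
Hypotheses (nNP : N <| P) (iPN : #|P : N| = p).

(* The Kaloujnine-Krasner embedding of P into N wr C_p, for the transversal
   1, x, .., x^(p-1) of N in P: an element a sends the i-th coset N x^i to the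
   j-th one, with cocycle x^i a x^-j in N. Here C_p is generated by g and the
   i-th copy of N acts below (g ^+ i) v. *)
Lemma wreath_contains_copy :
  contains_copy (rigid_stab G v) N -> contains_copy (rigid_stab G u) P.
Proof.
case=> f [f_inj fM fR].
have nN a (aP : a \in P) := fintype.subsetP (normal_norm nNP) a aP.
have cQ : #|P / N| = p by rewrite card_quotient ?normal_norm.
have [X defX] : exists X, P / N = <[X]>.
  by apply/cyclicP; rewrite prime_cyclic ?cQ.
have oX : #[X] = p by rewrite -cQ defX.
have [x [xN xP Xx]] : exists x, [/\ x \in 'N(N), x \in P & X = coset N x].
  have : X \in P / N by rewrite defX cycle_id.
  by case/morphimP => x xN xP Xx; exists x.
(* [s a] is a discrete logarithm of the coset of [a], determined only modulo [p]. Outside [P] its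
   value is arbitrary; 0 is taken. *)
have [s sP] : exists s : hT -> nat, forall a, a \in P -> coset N a = X ^+ s a.
  suff /boolp.choice[s sP] : forall a, exists n, a \in P -> coset N a = X ^+ n.
    by exists s.
  move=> a; case aP: (a \in P); last by exists 0.
  have : coset N a \in P / N by rewrite mem_quotient.
  by rewrite defX => /cycleP[i Xi]; exists i.
have sM a b : a \in P -> b \in P -> s (a * b) = s a + s b %[mod p].
  move=> aP bP; apply/eqP; rewrite -oX -eq_expg_mod_order -sP ?groupM //.
  by rewrite morphM ?nN //= !sP // expgD.
pose t a i := ((i + s a) %% p)%N.
have t_lt a i : (t a i < p)%N by rewrite ltn_mod prime_gt0.
have tM a b i : a \in P -> b \in P -> t (a * b) i = t b (t a i).
  by move=> aP bP; rewrite /t modnDml -addnA -[RHS]modnDmr -sM // modnDmr.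
pose c a i := x ^+ i * a * (x ^+ t a i)^-1.
have cN a i : a \in P -> c a i \in N.
  move=> aP; have aN := nN _ aP.
  apply: coset_idr; first by rewrite !groupM ?groupV ?groupX.
  rewrite !morphM ?morphV ?morphX ?groupM ?groupV ?groupX //= -Xx sP //.
  by rewrite -expgD /t -oX expg_mod_order mulgV.
have cM a b i : a \in P -> b \in P -> c (a * b) i = c a i * c b (t a i).
  by move=> aP bP; rewrite /c tM // !mulgA mulgKV.
(* The imprimitive action of N wr C_p on the [p] subtrees of the orbit. Off the orbit the base group
   is trivial and only the power of [g] remains. *)
pose spec a b := [/\ rigid_stab G u b,
  forall i w, (i < p)%N -> wprefix v w ->
    b ((g ^+ i) w) = (g ^+ t a i) (f (c a i) w) &
  forall w, ~ on_orbit w -> b w = (g ^+ s a) w].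
have [F FP] : exists F : hT -> tree_aut Y, forall a, a \in P -> spec a (F a).
  suff /boolp.choice[F FP] : forall a, exists b, a \in P -> spec a b.
    by exists F.
  move=> a; case aP: (a \in P); last by exists 1.
  have r i : (i < p)%N -> rigid_stab G ((g ^+ i) v) (f (c a i) ^ (g ^+ i)).
    move=> _; apply: rigid_stab_conj => //; last exact/fR/cN.
    by apply: set_groupX => //; case: gu.
  have [b [Gb bv bnv]] := rigid_stab_glue GG autX_disjoint r.
  exists (b * g ^+ s a) => _; split.
  - apply: set_groupM; [exact: rigid_stab_group| |]; last first.
      by apply: set_groupX => //; apply: rigid_stab_group.
    split=> // w uw; apply: bnv => i _; apply: contraNN uw.
    exact/wprefix_trans/autX_below.
  - move=> i w ip vw; rewrite /= (bv i) ?aut_prefix // aut_conj.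
    by rewrite /t autX_modp autXD.
  - move=> w ow /=; rewrite bnv // => i ip; apply/negP => iw.
    by apply: ow; exists i.
exists F; split.
(* The action on the subtree below [v], the copy of index 0, already determines [a]: the subtree
   reached gives [t a 0], the map onto it gives [c a 0], and together they recover [a]. *)
- have Finj1 a b : a \in P -> b \in P -> F a = F b ->
      c a 0 = c b 0 /\ t a 0 = t b 0.
    move=> aP bP Fab; have [_ Fa _] := FP a aP; have [_ Fb _] := FP b bP.
    have p0 := prime_gt0 pr_p.
    have E w : wprefix v w ->
        (g ^+ t a 0) (f (c a 0) w) = (g ^+ t b 0) (f (c b 0) w).
      by move=> vw; rewrite -Fa // -Fb // Fab.
    have pf h w : wprefix v w -> h \in N -> wprefix v (f h w).
      by move=> vw hN; rewrite (rigid_stab_wprefix _ (fR _ hN)).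
    have tE : t a 0 = t b 0.
      apply: (@autX_disjoint _ _ ((g ^+ t a 0) (f (c a 0) v))) => //.
        by rewrite aut_prefix pf ?wprefix_refl ?cN.
      by rewrite E ?wprefix_refl // aut_prefix pf ?wprefix_refl ?cN.
    split=> //; apply: f_inj; rewrite ?cN //; apply: aut_ext => w.
    have [vw|vw] := boolP (wprefix v w).
      by have := E w vw; rewrite tE => /aut_inj.
    have [_ ->] := fR _ (cN a 0%N aP); last by [].
    by have [_ ->] := fR _ (cN b 0%N bP).
  move=> a b aP bP /(Finj1 _ _ aP bP)[]; rewrite /c => cE tE.
  by move: cE; rewrite tE => /mulIg/mulgI.
- move=> a b aP bP; have [_ Fa Fa'] := FP a aP; have [_ Fb Fb'] := FP b bP.
  have [_ Fab Fab'] := FP _ (groupM aP bP).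
  apply: aut_ext => w /=; have [[i ip iw]|ow] := pselect (on_orbit w).
    have [z vz ->] : exists2 z, wprefix v z & w = (g ^+ i) z.
      exists (aut_inv (g ^+ i) w); last by rewrite aut_invK.
      by rewrite -(aut_prefix (g ^+ i)) aut_invK.
    rewrite Fab // Fa // Fb //; last first.
      by rewrite (rigid_stab_wprefix _ (fR _ (cN a i aP))).
    by rewrite cM // tM // fM ?cN.
  (* A power of [g] keeps [w] off the orbit, and [s] is additive modulo [p], which suffices since
     [g ^+ p = 1]. *)
  rewrite Fab' // Fa' // Fb'; last by move/on_orbitX.
  by rewrite -autXD -autX_modp sM // autX_modp.
- by move=> a /FP[].
Qed.

End Wreath.

(** * Climbing the tree *)

Lemma aut_moves (Y : nat -> finType) (g : tree_aut Y) :
  g <> 1 -> exists v, g v <> v.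
Proof.
move=> g1; apply: contrapT => /forallNP gv; apply: g1; apply: aut_ext => v.
apply: contrapT; exact: gv.
Qed.

(** Induction on the order of [P], for all vertices at once, because a normal subgroup of index [p]
    must be embedded at the moved vertex [v] rather than at [u]. *)
Lemma rigid_stab_copies_pgroup (Y : nat -> finType) (G : set (tree_aut Y)) p :
  group_closed [in G] -> prime p ->
  (forall u, exists g, [/\ rigid_stab G u g, g <> 1 & g ^+ p = 1]) ->
  forall (hT : finGroupType) (P : {group hT}) u,
    p.-group P -> contains_copy (rigid_stab G u) P.
Proof.
move=> GG pr_p Gp hT P; have [k] := ubnP #|P|.
elim: k P => // k IH P ltPk u pP.
have [P1|ntP] := eqVneq P 1%G.
  by apply: contains_copy_trivial; [apply: rigid_stab_group | rewrite P1].
have [_ _ [n cP]] := pgroup_pdiv pP ntP.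
have le_n : (n <= logn p #|P|)%N by rewrite cP pfactorK.
have [N [sNP nNP cN]] := normal_pgroup pP (normal_refl P) le_n.
have iPN : #|P : N| = p.
  by rewrite -divgS // cP cN expnS mulnK ?expn_gt0 ?prime_gt0.
have [g [gu g1 gp]] := Gp u; have [v gv] := aut_moves g1.
apply: (wreath_contains_copy GG pr_p gu gp gv nNP iPN); apply: IH.
  rewrite -ltnS; apply: leq_trans ltPk; rewrite ltnS cP cN ltn_exp2l //.
  exact: prime_gt1.
exact: pgroupS sNP pP.
Qed.

Lemma pgroups_of_rigid_stab (Y : nat -> finType) (G : set (tree_aut Y)) p :
  group_closed [in G] -> prime p ->
  (forall u, exists g, [/\ rigid_stab G u g, g <> 1 & g ^+ p = 1]) ->
  contains_all_finite_pgroups p G.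
Proof.
move=> GG pr_p Gp hT P pP.
have := rigid_stab_copies_pgroup GG pr_p Gp wnil pP.
by apply: contains_copy_sub => g [].
Qed.

(** The prime may change from vertex to vertex, hence the restriction to cyclic groups, where
    [x ^+ p] generates a subgroup of index [p] whatever prime [p] dividing the order occurs. The
    order [n] depends on [u] and is multiplied by a prime at each step. *)
Lemma rigid_stab_copies_cyclic (Y : nat -> finType) (G : set (tree_aut Y)) :
  group_closed [in G] ->
  (forall u, exists g, [/\ rigid_stab G u g, g <> 1 & finite_order g]) ->
  forall k u, exists2 n, (k < n)%N &
    forall (hT : finGroupType) (x : hT), #[x] = n ->
      contains_copy (rigid_stab G u) <[x]>.
Proof.
move=> GG Gf; elim=> [|k IH] u.
  exists 1%N => // hT x x1; apply: contains_copy_trivial.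
    exact: rigid_stab_group.
  by apply/eqP; rewrite trivg_card1 -/(#[x]) x1.
have [g0 [gu0 g01 [m m0 gm]]] := Gf u.
have [p [j [pr_p _ g1 gp]]] := finite_order_prime_power m0 gm g01.
have gu : rigid_stab G u (g0 ^+ j).
  by apply: set_groupX => //; apply: rigid_stab_group.
have [v gv] := aut_moves g1.
have [n kn copy] := IH v; exists (n * p)%N.
  by apply: (leq_ltn_trans kn); rewrite ltn_Pmulr ?prime_gt1 //
    (leq_ltn_trans _ kn).
move=> hT x ox; have oxp : #[x ^+ p] = n.
  by rewrite orderXdiv ox ?dvdn_mull // mulnK ?prime_gt0.
have sxp : <[x ^+ p]> \subset <[x]> by rewrite cycle_subG mem_cycle.
apply: (wreath_contains_copy GG pr_p gu gp gv _ _ (copy _ _ oxp)).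
  by rewrite -sub_abelian_normal // cycle_abelian.
rewrite -divgS // -!/(#[_]) oxp ox mulKn //; exact: leq_ltn_trans kn.
Qed.

Lemma unbounded_finite_order (Y : nat -> finType) (G : set (tree_aut Y)) :
  group_closed [in G] ->
  (forall u, exists g, [/\ rigid_stab G u g, g <> 1 & finite_order g]) ->
  forall N, exists g, G g /\ exists n, has_order g n /\ (N < n)%N.
Proof.
move=> GG Gf N; have [n Nn copy] := rigid_stab_copies_cyclic GG Gf N wnil.
have n0 : (0 < n)%N by apply: leq_ltn_trans Nn.
have [hT [x ox]] : exists (hT : finGroupType) (x : hT), #[x] = n.
  (* The type ['Z_n] would not do for [n = 1], where it has two elements. *)
  by exists 'I_n.-1.+1, Zp1; rewrite order_Zp1 prednK.
have [g [Gg _] go] := contains_cyclic_order (copy _ _ ox).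
by exists g; split=> //; exists n; rewrite -ox in Nn *; split.
Qed.

(** * Branching subgroups *)

(* psi^-1 of the element of K^m with single nontrivial entry k, iterated along
   the letters of u. *)
Lemma branching_lift m (K : set (tree_aut (regular_tree m))) :
  group_closed [in K] -> direct_power K `<=` psi_image K ->
  forall (u : word (regular_tree m)) k p, K k -> k <> 1 -> k ^+ p = 1 ->
  exists g, [/\ rigid_stab K u g, g <> 1 & g ^+ p = 1].
Proof.
move=> KG Kpsi u k p Kk k1 kp.
have [n] : exists n, wlen u = n by exists (wlen u).
elim: n u => [|n IH] [|y u] //= un; first by exists k.
have [h [[Kh hu] h1 hp]] := IH u (succn_inj un).
pose f : {ffun 'I_m -> tree_aut (regular_tree m)} :=
  [ffun z => if z == y then h else 1].
have [g [Kg g1] fg] : psi_image K f.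
  apply: Kpsi => z; rewrite ffunE; case: eqP => // _; exact: set_group1.
(* Since [g] fixes the first level, it keeps the first letter and acts on the rest by its section,
   which is [f z]. *)
have gE z w : g (wcons z w) = wcons z (f z w).
  have gz : g (wcons z wnil) = wcons z wnil by exact: g1.
  have: wprefix (wcons z wnil) (g (wcons z w)).
    by rewrite -{1}gz aut_prefix /= eqxx.
  rewrite -fg ffunE /= /section_fun /=.
  by case: (g _) => [|t w'] //= /andP[/eqP ->].
have g0 : g wnil = wnil.
  by have := aut_len g wnil; case: (g _).
exists g; split.
- split=> // -[|z w] /= uw; first exact: g0.
  by rewrite gE ffunE; case: (z =P y) uw => [->|//]; rewrite eqxx /= => /hu ->.
- move=> gE1; apply: h1; apply: aut_ext => w.
  by have := gE y w; rewrite gE1 ffunE eqxx => -[].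
- have g0X q : iter q g wnil = wnil by elim: q => //= q ->.
  have gX q z w : iter q g (wcons z w) = wcons z (iter q (f z) w).
    by elim: q => //= q ->; rewrite gE.
  apply: aut_ext => -[|z w]; rewrite autX ?g0X // gX -autX ffunE.
  case: eqP => _; first by rewrite hp.
  by rewrite expg1n.
Qed.

(** One element of prime order [p] in [K] is lifted to every vertex, so the same [p] serves the
    whole tree. *)
Lemma branching_pgroups m (G K : set (tree_aut (regular_tree m))) :
  group_closed [in G] -> is_subgroup K G ->
  direct_power K `<=` psi_image K -> ~ torsion_free K ->
  exists p, prime p /\ contains_all_finite_pgroups p G.
Proof.
move=> GG [KG KK] Kpsi.
move=> /existsNP[k /not_implyP[Kk /not_implyP[[n n0 kn] k1]]].
have [p [j [pr_p _ kj1 kjp]]] := finite_order_prime_power n0 kn k1.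
exists p; split=> //; apply: pgroups_of_rigid_stab => // u.
have [g [gu g1 gp]] := branching_lift KK Kpsi u (set_groupX j KK Kk) kj1 kjp.
by exists g; split=> //; apply: rigid_stab_sub gu.
Qed.

Lemma weakly_branch_finite_order (Y : nat -> finType) (G : set (tree_aut Y)) :
  weakly_branch G -> torsion G ->
  forall u, exists g, [/\ rigid_stab G u g, g <> 1 & finite_order g].
Proof.
by move=> [_ wb] tor u; have [g gu g1] := wb u; exists g;
   split=> //; apply: tor gu.1.
Qed.

Theorem theorem6p9 :
  (forall (Y : nat -> finType) (hY : forall i, (1 < #|Y i|)%N)
      (G : set (tree_aut Y)) (hG : group_closed [in G]),
    (forall u : word Y,
      exists g, [/\ rigid_stab G u g, g <> 1 & finite_order g]) ->
    forall N : nat,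
      exists g, G g /\ exists n : nat, has_order g n /\ (N < n)%N) /\
  (forall (Y : nat -> finType) (hY : forall i, (1 < #|Y i|)%N)
      (G : set (tree_aut Y)) (hG : group_closed [in G]),
    weakly_branch G -> torsion G -> ~ finite_exponent G) /\
  (forall (p : nat) (hp : prime p)
      (Y : nat -> finType) (hY : forall i, (1 < #|Y i|)%N)
      (G : set (tree_aut Y)) (hG : group_closed [in G]),
    weakly_branch G -> is_pgroup p G -> contains_all_finite_pgroups p G) /\
  (forall (m : nat) (hm : (1 < m)%N)
      (G : set (tree_aut (regular_tree m))) (hG : group_closed [in G]),
    weakly_regular_branch G ->
    (exists K, torsion_free K /\ weakly_regular_branch_over G K) \/
    (exists p : nat, prime p /\ contains_all_finite_pgroups p G)) /\
  (forall (m : nat) (hm : (1 < m)%N)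
      (G : set (tree_aut (regular_tree m))) (hG : group_closed [in G]),
    regular_branch G ->
    virtually_torsion_free G \/
    (exists p : nat, prime p /\ contains_all_finite_pgroups p G)).
Proof.
split; first by move=> Y _ G GG Gf N; apply: unbounded_finite_order.
split.
  move=> Y _ G GG wb tor [e e0 Ge].
  have [g [Gg [n [[_ _ gn] en]]]] :=
    unbounded_finite_order GG (weakly_branch_finite_order wb tor) e.
  by apply: (gn e); rewrite ?e0 ?Ge.
split.
  move=> p pr_p Y _ G GG [_ wb] pG; apply: pgroups_of_rigid_stab => // u.
  have [g gu g1] := wb u; have [k [pk0 gpk _]] := pG g gu.1.
  have [q [j [pr_q qp gj1 gjq]]] := finite_order_prime_power pk0 gpk g1.
  (* The prime [q] divides the order of [g], a power of [p]. *)
  have qE : q = p.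
    by move: (Euclid_dvdX p k pr_q); rewrite qp dvdn_prime2 //
      => /esym/andP[/eqP].
  exists (g ^+ j); rewrite -qE; split=> //.
  by apply: set_groupX => //; apply: rigid_stab_group.
split=> m _ G GG.
  (* The alternative is decided by whether the given branching subgroup is itself torsion-free; no
     other subgroup has to be constructed. *)
  move=> [K KG]; have [Kt|Kt] := pselect (torsion_free K).
    by left; exists K.
  right; by case: KG => _ _ sK _ Kpsi; apply: branching_pgroups Kt.
move=> [_ _ [K [sK fK Kpsi _]]].
have [Kt|Kt] := pselect (torsion_free K); [by left; exists K|right].
exact: branching_pgroups Kt.
Qed.
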